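(* If $G$ is a connected circular arc graph, then the intersection of the vertex sets of all longest paths in $G$ is nonempty.
   Context: A graph $G$ is a circular arc graph if there is a map assigning to each vertex an open arc of a circle such that two distinct vertices are adjacent if and only if their arcs intersect. A longest path is a path in $G$ with the maximum number of vertices among all paths of $G$. *)

(* Defs.v *)
From HB Require Import structures.
From mathcomp Require Import all_boot all_order all_algebra.
From mathcomp Require Import classical_sets reals trigo.

Set Implicit Arguments.
Unset Strict Implicit.
Unset Printing Implicit Defensive.

Import Order.TTheory GRing.Theory Num.Theory.
Local Open Scope classical_set_scope.
Local Open Scope ring_scope.

Definition circle_point (R : realType) (t : R) : R * R := (cos t, sin t).

Definition arc_of_angles (R : realType) (a b : R) : set (R * R) :=
  [set circle_point t | t in [set t : R | a < t < b]].

(* Open arcs are nonempty and proper: the circle minus one point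
   (b = a + 2 pi) is an open arc, the whole circle is not. *)
Definition open_arc (R : realType) (A : set (R * R)) : Prop :=
  exists a b : R, [/\ a < b, b <= a + pi *+ 2 & A = arc_of_angles a b].

Definition simple_graph (V : finType) (e : rel V) : Prop :=
  symmetric e /\ irreflexive e.

(* The graph without vertices is not connected. *)
Definition connected_graph (V : finType) (e : rel V) : Prop :=
  (0 < #|V|)%N /\ forall x y : V, connect e x y.

Definition circular_arc_graph (R : realType) (V : finType) (e : rel V) : Prop :=
  exists arc : V -> set (R * R),
    (forall v, open_arc (arc v)) /\
    (forall u v, u != v -> (e u v <-> arc u `&` arc v !=set0)).

Definition graph_path (V : finType) (e : rel V) (p : seq V) : Prop :=
  [/\ p != [::], uniq p & sorted e p].

Definition longest_path (V : finType) (e : rel V) (p : seq V) : Prop :=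
  graph_path e p /\ forall q : seq V, graph_path e q -> (size q <= size p)%N.

(* Main.v *)
(* Only finitely many points of the circle matter, one for each pair of
   intersecting arcs. An inclusion-maximal arc K missed by a longest path P
   contains no point shared by two consecutive arcs of P (K could be inserted
   there), so P lives on the line obtained by removing K, where its arcs become
   intervals. A path of intervals can be rearranged greedily by right ends.

   Core: let J be a maximal arc of P off Q, I a maximal arc of Q off P, and let
   I and J meet or be linked by arcs in neither path. Rearranging P away from I
   and Q away from J and cutting each behind its last arc reaching the link, the
   four pieces recombine across the link into two paths with more than
   |P| + |Q| vertices in total, so P or Q was not longest.

   If every vertex is missed by a longest path, take a longest path P and a
   component C of the maximal arcs off P, with C as large as possible, an arc J
   of P adjacent to C, and a longest path Q off J. If Q meets C the core applies;
   otherwise C and J lie in a component of the maximal arcs off Q that is larger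
   than C. *)
Require Import Defs.
From HB Require Import structures.
From mathcomp Require Import all_boot all_order all_algebra.
From mathcomp Require Import zify.
From mathcomp Require boolp.

Set Implicit Arguments.
Unset Strict Implicit.
Unset Printing Implicit Defensive.

(** * Greedy arrangement of paths of intervals *)

Ltac arith :=
  repeat match goal with
  | H : is_true (_ <= _) |- _ => revert H
  | H : is_true ((_ <= _) && (_ <= _)) |- _ => revert H
  | H : is_true (~~ ((_ <= _) && (_ <= _))) |- _ => revert H
  | H : @eq nat _ _ |- _ => revert H
  | H : @eq nat _ _ -> False |- _ => revert H
  | H : ~ @eq nat _ _ |- _ => revert H
  end; clear; intros; lia.

(** * Counting the blocks that a set of entries cuts out of a sequence *)

Section Runs.
Variable T : eqType.
Implicit Types (X Y : pred T) (s : seq T) (b : bool).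

(* The number of maximal blocks of consecutive entries of [s] in [X]; [b] tells
   whether the entry preceding [s] is in [X]. *)
Fixpoint runs X b s : nat :=
  if s is x :: s' then (X x && ~~ b) + runs X (X x) s' else 0.

Lemma eq_runs X Y b s : {in s, X =1 Y} -> runs X b s = runs Y b s.
Proof.
elim: s b => //= x s IH b eqXY; rewrite eqXY ?mem_head // IH // => y ys.
by rewrite eqXY // inE ys orbT.
Qed.

Lemma runs_gt0 X s x : x \in s -> X x -> 0 < runs X false s.
Proof.
move=> xs Xx; elim: s xs => //= y s IH; rewrite inE => /orP[/eqP <-|/IH].
  by rewrite Xx.
by case: (X y) => //=.
Qed.

Lemma runs_le1 X s : {in s, forall x, X x} -> runs X false s <= 1.
Proof.
case: s => //= x s Xs; rewrite Xs ?mem_head //= ltnS leqn0.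
have {Xs} : {in s, forall y, X y} by move=> y ys; apply: Xs; rewrite inE ys orbT.
elim: s => //= y s IH Xs; rewrite Xs ?mem_head //= IH // => z zs.
by apply: Xs; rewrite inE zs orbT.
Qed.

(** No entry of [X] stands next to an entry of [Y], so no block of the union mixes the two sets. *)
Lemma runs_or X Y s :
    (forall x, ~~ (X x && Y x)) ->
    sorted (fun x y => ~~ (X x && Y y) && ~~ (Y x && X y)) s ->
  runs (predU X Y) false s = runs X false s + runs Y false s.
Proof.
move=> disj; case: s => //= x s.
elim: s x => [|y s IH] x /=; first by move: (disj x); case: (X x); case: (Y x).
case/andP=> nxy /IH /=; move: (disj x) (disj y) nxy.
by case: (X x); case: (Y x); case: (X y); case: (Y y) => //= _ _ _; arith.
Qed.

Lemma runs_b X b s : runs X b s <= runs X false s <= (runs X b s).+1.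
Proof. by case: s => //= x s; case: b; case: (X x) => //=; arith. Qed.

(** As [z] occurs at most once, adding it can at worst join the two blocks beside it. *)
Lemma runs_add1 X z s : uniq s -> ~~ X z ->
  runs X false s <= (runs (predU X (pred1 z)) false s).+1.
Proof.
move=> us nXz.
suff /(_ false) : forall b, runs X b s <= (runs (predU X (pred1 z)) b s).+1 by [].
elim: s us => //= x s IH /andP[xs us] b.
case: (eqVneq x z) => [eq_xz|ne_xz]; last first.
  by rewrite orbF; have := IH us (X x); arith.
rewrite eq_xz (negbTE nXz) /= (@eq_runs (predU X (pred1 z)) X).
  by have := runs_b X true s; case: b => /=; arith.
move=> y ys /=; case: (eqVneq y z) => [eq_yz|]; last by rewrite orbF.
by move: xs; rewrite eq_xz -eq_yz ys.
Qed.

End Runs.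

(** * Greedy orderings and the blocks they leave *)

Section Greedy.
Variables (T : eqType) (l r : T -> nat).
Implicit Types (x y z a b c : T) (s rv later : seq T) (Y : pred T).

Definition overlap x y := (l x <= r y) && (l y <= r x).

Lemma overlapC x y : overlap x y = overlap y x.
Proof. by rewrite /overlap andbC. Qed.

(* [rv] is a path listed backwards, [later] the vertices not yet visited: the
   path starts at a vertex with least right end and always proceeds to an
   unvisited neighbour with least right end. *)
Fixpoint greedy rv later : bool :=
  if rv is a :: rv' then
    (if rv' is b :: _ then
       overlap b a && all (fun z => overlap b z ==> (r a <= r z)) later
     else all (fun z => r a <= r z) later)
    && greedy rv' (a :: later)
  else true.

Lemma greedy_cons a b rv later :
  greedy (a :: b :: rv) later =
  [&& overlap b a, all (fun z => overlap b z ==> (r a <= r z)) later &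
      greedy (b :: rv) (a :: later)].
Proof. by rewrite andbA. Qed.

Lemma greedy_perm rv s1 s2 : perm_eq s1 s2 -> greedy rv s1 -> greedy rv s2.
Proof.
elim: rv s1 s2 => //= a rv IH s1 s2 eqs /andP[h /IH ->].
  by rewrite andbT; case: rv {IH} h => [|b rv]; rewrite (perm_all _ eqs).
by rewrite perm_cons.
Qed.

Lemma greedy_cat s1 s2 later :
  greedy (s1 ++ s2) later -> greedy s2 (catrev s1 later).
Proof. by elim: s1 later => //= a s1 IH later /andP[_ /IH]. Qed.

Lemma greedy_sorted rv later : greedy rv later -> sorted overlap rv.
Proof.
elim: rv later => //= a rv IH later /andP[h /IH].
by case: rv h {IH} => //= b rv /andP[+ _ ->]; rewrite overlapC => ->.
Qed.

(** If a pending [z] ended before the newly chosen [a] begins, it would still overlap the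
    predecessor [c] of [a]: [l c <= r z] by induction, and [c] reaches [a]. Having the smaller right
    end, [z] would have been chosen in place of [a]. *)
Lemma greedy_left rv later : {in rv ++ later, forall x, l x <= r x} -> greedy rv later ->
  forall b z, b \in rv -> z \in later -> l b <= r z.
Proof.
elim: rv later => //= a rv IH later le_lr /andP[h /IH{}IH] b z.
have {}IH : forall b z, b \in rv -> z \in a :: later -> l b <= r z.
  apply: IH => x; rewrite mem_cat inE => xs; apply: le_lr.
  by rewrite inE mem_cat; case/or3P: xs => ->; rewrite ?orbT.
rewrite inE => /orP[/eqP->{b} zl|brv zl]; last by apply: IH; rewrite // inE zl orbT.
have la := le_lr _ (mem_head _ _).
have lz : l z <= r z by apply: le_lr; rewrite inE mem_cat zl !orbT.
case: rv h IH {le_lr} => [/allP/(_ _ zl)/=|c rv /andP[ca /allP/(_ _ zl) h] IH].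
  by move=> h _; apply: leq_trans h.
have := IH c z; rewrite mem_head inE zl orbT => /(_ isT isT) lcz.
move: h ca; rewrite /overlap lcz /=; arith.
Qed.

(* Backwards from a stuck end, every vertex reaching further right than its
   successors is deleted; each deletion separates one more block. *)
Lemma greedy_runs s rv later Y :
    uniq s -> sorted overlap s -> uniq (rv ++ later) ->
    {in rv ++ later, forall x, l x <= r x} -> greedy rv later ->
    {subset rv <= s} -> rv != [::] ->
    (forall y, Y y -> (y \in later) && (r (head y rv) < l y)) ->
  (runs Y false s).+1 <= runs (predU (mem rv) Y) false s.
Proof.
move=> us ss; have [n le_n] := ubnP (size rv).
elim: n rv later Y le_n => // n IH [|a rv] // later Y; rewrite ltnS => le_n.
move=> urv le_lr gr sub _ /= Yright.
have Yl y : Y y -> y \in later by move=> /Yright/andP[].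
have notYrv y : y \in a :: rv -> ~~ Y y.
  move=> yrv; apply/negP => /Yl yl; move: urv; rewrite cat_uniq.
  by case/and3P=> _ /hasPn/(_ _ yl) /negP[].
have sep (X Z : pred T) : (forall x z, X x -> Z z -> r x < l z) ->
    (forall x, ~~ (X x && Z x)) ->
    runs (predU X Z) false s = runs X false s + runs Z false s.
  move=> XZ dXZ; apply: runs_or => //; apply: sub_sorted ss => x y /andP[xy yx].
  apply/andP; split; apply/negP => /andP[h1 h2].
    by have := XZ _ _ h1 h2; arith.
  by have := XZ _ _ h2 h1; arith.
have [|/hasPn none] := boolP (has (fun x => r a < r x) rv); last first.
  (* Nothing on the path reaches beyond [a], so the path is separated from [Y] and contributes a
     block of its own. *)
  have -> : runs (predU (mem (a :: rv)) Y) false s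
      = runs (mem (a :: rv)) false s + runs Y false s.
    apply: sep => [x y|x]; last by apply/negP => /andP[/notYrv/negP].
    rewrite inE => /orP[/eqP->|/none] /=; first by case/Yright/andP.
    by move=> + /Yright/andP[_]; arith.
  rewrite -addn1 addnC leq_add2r.
  by apply: (@runs_gt0 _ _ _ a); rewrite ?sub ?mem_head //= mem_head.
(* Here [z] is the latest vertex before [a] that reaches further right than [a]. It was preferred to
   all of [a :: s1], so these do not overlap its predecessor [b] and lie to the right of it. *)
move=> hz; case/split_find: hz le_n urv le_lr gr sub notYrv => {rv} z s1 s2 az /hasPn as1.
rewrite cat_rcons => le_n urv le_lr gr sub notYrv.
have := @greedy_cat (a :: s1) (z :: s2) later gr.
set later' := catrev _ _ => gr'.
have mem_later' x : (x \in later') = [|| x == a, x \in s1 | x \in later].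
  by rewrite /later' catrevE mem_cat mem_rev inE orbA.
have r_later' x : x \in a :: s1 -> r x < r z.
  by rewrite inE => /orP[/eqP-> //|/as1]; arith.
(* A starting vertex has the least right end of all, so [z] does have a predecessor. *)
case: s2 => [|b s3] in le_n urv le_lr gr gr' sub notYrv *.
  move: gr' => /= /andP[/allP/(_ a)]; rewrite mem_later' eqxx => /(_ isT).
  by move: az; arith.
have perm_later' : perm_eq ((a :: s1 ++ z :: b :: s3) ++ later) ((z :: b :: s3) ++ later').
  apply/permP => p; rewrite /later' catrevE -cat_cons !count_cat count_rev /=.
  arith.
have le_lr' : {in (z :: b :: s3) ++ later', forall x, l x <= r x}.
  by move=> x; rewrite -(perm_mem perm_later'); exact: le_lr.
have gl := greedy_left le_lr' gr'.
have [/andP[bz /allP zmin] gr''] := andP gr'.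
(* The path is shortened to end at [b], [z] is deleted, and [a :: s1] joins the vertices to the
   right. [Y'] has at least one block more than [Y], and putting [z] back loses at most one. *)
set Y' := predU (mem (a :: s1)) Y.
have a_in x : x \in a :: s1 -> x \in later' by rewrite mem_later' inE orbA => ->.
have b_left x : x \in a :: s1 -> r b < l x.
  move=> xs; have := zmin _ (a_in _ xs).
  rewrite /overlap (gl b) ?mem_head ?inE ?eqxx ?orbT ?a_in //.
  by have := r_later' _ xs; arith.
have Y'right y : Y' y -> (y \in z :: later') && (r (head y (b :: s3)) < l y).
  case/orP => [ys|Yy]; first by rewrite inE a_in ?orbT //= b_left.
  rewrite inE mem_later' /=.
  have /andP[-> ray] := Yright _ Yy; rewrite !orbT /=.
  have := b_left _ (mem_head _ _); have := le_lr _ (mem_head _ _); arith.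
have {IH} := IH (b :: s3) (z :: later') Y' _ _ _ gr'' _ isT Y'right.
have -> : runs Y' false s = runs (mem (a :: s1)) false s + runs Y false s.
  apply: sep => [x y|x].
    rewrite inE => /orP[/eqP->|/as1] /=; first by case/Yright/andP.
    by move=> + /Yright/andP[_]; arith.
  apply/negP => /andP[xs]; apply/negP/notYrv.
  by move: xs; rewrite !inE mem_cat => /orP[->|->]; rewrite ?orbT.
have : 0 < runs (mem (a :: s1)) false s.
  by apply: (@runs_gt0 _ _ _ a); rewrite ?sub ?mem_head //= mem_head.
have uz : uniq (z :: (b :: s3) ++ later').
  by rewrite -cat_cons -(perm_uniq perm_later') .
have := @runs_add1 _ (predU (mem (b :: s3)) Y') z s us.
rewrite (@eq_runs _ (predU _ (pred1 z)) (predU (mem (a :: s1 ++ z :: b :: s3)) Y)); last first.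
  move=> x _ /=; rewrite /Y' /= !inE mem_cat !inE.
  by case: (x == a); case: (x \in s1); case: (x == z);
    case: (x == b); case: (x \in s3); case: (Y x).
have -> : ~~ predU (mem (b :: s3)) Y' z.
  have zn : z \notin a :: s1.
    move: uz; rewrite /= => /andP[zn _]; apply/negP => /a_in zl.
    by move: zn; rewrite in_cons mem_cat zl !orbT.
  apply/negP => /= /orP[zb|/orP[]]; last 1 first.
  - by apply/negP/notYrv; rewrite inE mem_cat mem_head !orbT.
  - have /andP[/negP zn' _] :
      (z \notin (b :: s3) ++ later') && uniq ((b :: s3) ++ later') := uz.
    by apply: zn'; rewrite mem_cat zb.
  - by apply/negP.
move=> /(_ isT) h1 h2 h3.
have /h3 {h3} : size (b :: s3) < n by move: le_n; rewrite /= size_cat /=; arith.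
have perm2 : perm_eq ((b :: s3) ++ z :: later') (z :: (b :: s3) ++ later').
  by apply/permP => p; rewrite /= !count_cat /=; arith.
rewrite (perm_uniq perm2) uz => /(_ isT) h3.
have /h3{h3} : {in (b :: s3) ++ z :: later', forall x, l x <= r x}.
  by move=> x; rewrite (perm_mem perm2); exact: le_lr'.
have /[swap]/[apply] : {subset b :: s3 <= s}.
  by move=> x xs; apply: sub; rewrite inE mem_cat in_cons xs !orbT.
arith.
Qed.

End Greedy.

Lemma seq_argmin (T : eqType) (f : T -> nat) (p : pred T) (s : seq T) :
  has p s -> exists z, [/\ z \in s, p z & forall y, y \in s -> p y -> f z <= f y].
Proof.
move=> hp; pose q n := has (fun x => p x && (f x == n)) s.
have exq : exists n, q n.
  by case/hasP: hp => x xs px; exists (f x); apply/hasP; exists x; rewrite ?px /=.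
case: (ex_minnP exq) => _ /hasP[z zs /andP[pz /eqP <-]] minz.
by exists z; split=> // y ys py; apply: minz; apply/hasP; exists y; rewrite ?py /=.
Qed.

(** * Existence of greedy arrangements, and where to cut them *)

Section Split.
Variables (T : eqType) (l r : T -> nat).
Implicit Types (x y z a b c : T) (s rv later : seq T).

(** If the greedy walk got stuck early, all vertices left over would lie to the right of the current
    one, and [greedy_runs] would give [s] at least two blocks as a subset of itself, where it has
    only one. *)
Lemma greedy_exists s :
    uniq s -> sorted (overlap l r) s -> {in s, forall x, l x <= r x} ->
  exists2 rv, perm_eq rv s & greedy l r rv [::].
Proof.
move=> us ss le_lr.
case: s us ss le_lr => [|x0 s0]; first by exists [::].
set s := x0 :: s0 => us ss le_lr.
suff step n rv later : size later = n -> rv != [::] -> perm_eq (rv ++ later) s ->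
    greedy l r rv later -> exists2 rv, perm_eq rv s & greedy l r rv [::].
  have [|z [zs _ zmin]] := @seq_argmin _ r predT s; first by [].
  apply: (step (size (rem z s)) [:: z] (rem z s)) => //.
    by rewrite perm_sym perm_to_rem.
  by apply/andP; split=> //; apply/allP => y /mem_rem ys; apply: zmin.
elim: n rv later => [|n IH] [|a rv] // later szl _ perm_s gr.
  by exists (a :: rv); rewrite ?(size0nil szl) ?cats0 // in perm_s gr *.
have [nbr|/hasPn stuck] := boolP (has (overlap l r a) later).
  have [z [zl oz zmin]] := seq_argmin r nbr.
  have perm_l := perm_to_rem zl.
  apply: (IH (z :: a :: rv) (rem z later)) => //.
  - by rewrite size_rem // szl.
  - apply: perm_trans perm_s.
    by apply/permP => p; rewrite /= !count_cat (permP perm_l) /=; arith.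
  have gr' : greedy l r (a :: rv) (z :: rem z later) by apply: greedy_perm gr.
  rewrite greedy_cons oz gr' andbT.
  by apply/allP => y /mem_rem yl; apply/implyP; apply: zmin.
have urv : uniq ((a :: rv) ++ later) by rewrite (perm_uniq perm_s).
have le_lr' : {in (a :: rv) ++ later, forall x, l x <= r x}.
  by move=> x; rewrite (perm_mem perm_s); exact: le_lr.
have gl := greedy_left le_lr' gr.
have sub_rv : {subset a :: rv <= s}.
  by move=> x xs; rewrite -(perm_mem perm_s) mem_cat xs.
have sub_l : {subset later <= s}.
  by move=> x xs; rewrite -(perm_mem perm_s) mem_cat xs orbT.
have right y : mem later y -> (y \in later) && (r (head y (a :: rv)) < l y).
  move=> yl; apply/andP; split=> //=; have := stuck _ yl.
  rewrite /overlap gl ?mem_head //=; arith.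
have := greedy_runs us ss urv le_lr' gr sub_rv isT right.
have : runs (predU (mem (a :: rv)) (mem later)) false s <= 1.
  by apply: runs_le1 => x; rewrite -(perm_mem perm_s) mem_cat.
case: later szl {perm_s gr stuck urv le_lr' gl right} sub_l => // y later _ sub_l.
have : 0 < runs (mem (y :: later)) false s.
  by apply: (@runs_gt0 _ _ _ y); rewrite ?sub_l ?mem_head //= mem_head.
arith.
Qed.

(** No visited vertex ends before [c] begins, so [c] is a candidate at every choice, and each vertex
    preferred to it has a right end no larger. *)
Lemma greedy_prefix rv later c :
    {in rv ++ later, forall x, l x <= r x} -> greedy l r rv later -> c \in later ->
    {in rv, forall x, l c <= r x} ->
  {in rv, forall x, r x <= r c}.
Proof.
elim: rv later => //= a rv IH later le_lr /andP[h gr] cl lc x.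
have {gr}IH : {in rv, forall x, r x <= r c}.
  apply: IH gr _ _ => [y||y yrv]; last by apply: lc; rewrite inE yrv orbT.
    rewrite mem_cat inE => ys; apply: le_lr.
    by rewrite inE mem_cat; case/or3P: ys => ->; rewrite ?orbT.
  by rewrite inE cl orbT.
rewrite inE => /orP[/eqP->{x}|/IH//].
case: rv h IH lc le_lr => [/allP/(_ _ cl)//|b rv] /andP[_ /allP/(_ _ cl)] h IH lc le_lr.
have := lc b; rewrite !inE eqxx !orbT => /(_ isT) lcb.
have := IH b; rewrite mem_head => /(_ isT) rbc.
have := le_lr b; rewrite !inE eqxx !orbT => /(_ isT) lrb.
by move: h; rewrite /overlap (leq_trans lrb rbc) lcb.
Qed.

(** The greedy arrangement, listed backwards, is cut at the last visited vertex [a] that is [J] or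
    in [C]. Until then [a] was always available, so everything visited before ends by [r a <= r J].
    The vertex visited after [a] meets [a], hence begins by [r J] and meets [J]: the tail [t2] can
    be hung on [J] instead. *)
Lemma split_arrangement s J (C : pred T) :
    uniq s -> sorted (overlap l r) s -> {in s, forall x, l x <= r x} -> J \in s ->
    {in s, forall x, l J <= r x} ->
    {in s, forall c, C c -> {in s, forall x, l c <= r x} /\ r c <= r J} ->
  exists t2 a t1,
    [/\ perm_eq (t2 ++ a :: t1) s, C a \/ a = J,
        {in t2, forall x, x != J /\ ~~ C x},
        {in a :: t1, forall x, r x <= r J} &
    [/\ sorted (overlap l r) t2, sorted (overlap l r) (a :: t1) &
        forall t x, t2 = rcons t x -> overlap l r x J]].
Proof.
move=> us ss le_lr Js lJ hC; have [rv perm_s gr] := greedy_exists us ss le_lr.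
have hasJ : has (fun x => (x == J) || C x) rv.
  by apply/hasP; exists J; rewrite ?eqxx // (perm_mem perm_s).
have sub_rv x : x \in rv -> x \in s by rewrite (perm_mem perm_s).
case/split_find: hasJ perm_s gr sub_rv => {rv} a t2 t1 Ca nt2.
rewrite cat_rcons => perm_s gr sub_rv; exists t2, a, t1.
have sub1 x : x \in a :: t1 -> x \in s.
  by move=> xt; apply: sub_rv; rewrite mem_cat xt orbT.
have as_ : a \in s by rewrite sub1 ?mem_head.
have {}Ca : C a \/ a = J by case/orP: Ca => [/eqP|]; [right|left].
have [la ra] : {in s, forall x, l a <= r x} /\ r a <= r J.
  by case: Ca => [/hC|->]; [apply|].
have := greedy_cat gr => /= /andP[_ gr1].
have t1a : {in t1, forall x, r x <= r a}.
  apply: greedy_prefix gr1 _ _ => [x|//|x xt]; last by apply/la/sub1; rewrite inE xt orbT.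
    rewrite mem_cat inE catrevE cats0 mem_rev => xs; apply/le_lr/sub_rv.
    by rewrite mem_cat inE; case/or3P: xs => ->; rewrite ?orbT.
  by rewrite mem_head.
have ss' := greedy_sorted gr.
have [ss2 ss1] := cat_sorted2 ss'.
split=> //; last first.
  split=> // t x def_t; have xs : x \in s.
    by apply: sub_rv; rewrite def_t mem_cat mem_rcons mem_head.
  rewrite /overlap lJ // andbT.
  move: ss'; rewrite def_t cat_rcons => /cat_sorted2[_ /=].
  by case/andP=> + _; rewrite /overlap => /andP[xa _]; apply: leq_trans xa ra.
- by move=> x; rewrite inE => /orP[/eqP->//|/t1a xa]; apply: leq_trans ra.
- move=> x xt; apply/andP; rewrite -negb_or; apply: contra nt2 => h.
  by apply/hasP; exists x.
Qed.

End Split.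

(** * Exchanging pieces of two longest paths *)

Lemma sorted_pairs (T : Type) (R : rel T) (s : seq T) :
  (forall s1 a b s2, s = s1 ++ a :: b :: s2 -> R a b) -> sorted R s.
Proof.
case: s => //= a s; elim: s a => //= b s IH a h; rewrite (h [::] a b s) //=.
by apply: IH => s1 c d s2 eq_s; apply: (h (a :: s1) c d s2); rewrite eq_s.
Qed.

Lemma sorted_consecutive (T : Type) (R : rel T) s1 a b s2 :
  sorted R (s1 ++ a :: b :: s2) -> R a b.
Proof. by case/cat_sorted2 => _ /= /andP[]. Qed.

Lemma uniq_consecutive (T : eqType) (s1 s2 : seq T) a b :
  uniq (s1 ++ a :: b :: s2) -> a != b.
Proof.
by rewrite cat_uniq => /and3P[_ _ /=]; rewrite inE negb_or => /andP[/andP[]].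
Qed.

(** Overlap has to imply adjacency, but not conversely: two arcs may also meet away from their
    chosen intervals. *)
Definition interval_path (V : finType) (e : rel V) (l r : V -> nat) (s : seq V) :=
  [/\ {in s, forall x, l x <= r x}, sorted (overlap l r) s &
      {in s &, forall x y, x != y -> overlap l r x y -> e x y}].

Section Exchange.
Variables (V : finType) (e : rel V).
Implicit Types (P Q W X T s : seq V) (I J a b m : V).
Hypothesis simple_e : simple_graph e.

Lemma interval_path_sorted l r P s : interval_path e l r P -> {subset s <= P} ->
  uniq s -> sorted (overlap l r) s -> sorted e s.
Proof.
case=> _ _ ePe sP us ss; apply: sorted_pairs => s1 a b s2 eq_s.
apply: ePe; rewrite ?sP ?eq_s ?mem_cat ?inE ?eqxx ?orbT //.
  by apply: (@uniq_consecutive _ s1 s2); rewrite -eq_s.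
by apply: (@sorted_consecutive _ _ s1 _ _ s2); rewrite -eq_s.
Qed.

Lemma sorted_join X m M a T : sorted e X -> (forall t x, X = rcons t x -> e x m) ->
  path e m M -> e (last m M) a -> sorted e (a :: T) -> sorted e (X ++ m :: M ++ a :: T).
Proof.
move=> sX Xm mM Ma aT; have mMT : path e m (M ++ a :: T) by rewrite cat_path mM /= Ma.
case: (lastP X) Xm sX => // t x Xm; rewrite cat_rcons.
case: t {Xm}(Xm t x erefl) => [|y t] xm /=; first by rewrite xm.
by rewrite cat_path rcons_path /= => /andP[-> ->]; rewrite xm.
Qed.

Lemma uniq_join X m M T : uniq X -> uniq M -> uniq T ->
    m \notin X -> m \notin M -> m \notin T ->
    {in X, forall x, x \notin M /\ x \notin T} -> {in M, forall x, x \notin T} ->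
  uniq (X ++ m :: M ++ T).
Proof.
move=> uX uM uT mX mM mT XMT MT.
rewrite cat_uniq uX /= mem_cat (negbTE mM) (negbTE mT) cat_uniq uM uT /= !andbT.
rewrite negb_or mX /=; apply/andP; split; apply/hasPn => x.
  rewrite mem_cat; apply: contraL => /XMT[xM xT].
  by rewrite negb_or xM.
by apply: contraL => /MT.
Qed.

(* Each path is cut behind its last vertex adjacent to the middle part, and the
   pieces are recombined across the link [J, W, I]; together the two new paths
   have all vertices of [P] and [Q], and [I], [J] and [W] (twice) in addition. *)
Lemma exchange P Q W I J lP rP lQ rQ (C : pred V) :
    longest_path e P -> longest_path e Q ->
    J \in P -> J \notin Q -> I \in Q -> I \notin P ->
    uniq W -> {in W, forall w, w \notin P /\ w \notin Q} -> path e J (rcons W I) ->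
    interval_path e lP rP P -> interval_path e lQ rQ Q ->
    {in P, forall x, lP J <= rP x} -> {in Q, forall x, lQ I <= rQ x} ->
    {in P, forall c, C c ->
      [/\ {in P, forall x, lP c <= rP x}, rP c <= rP J & e (head I W) c]} ->
    {in Q, forall c, C c ->
      [/\ {in Q, forall x, lQ c <= rQ x}, rQ c <= rQ I & e (last J W) c]} ->
    {in P, forall z, z \in Q -> C z || (rP J < rP z) && (rQ I < rQ z)} ->
  False.
Proof.
move=> [[nP uP sP] maxP] [[nQ uQ sQ] maxQ] JP JQ IQ IP uW WPQ JWI iP iQ lJ lI CP CQ PQ.
have e_sym := simple_e.1.
have [leP oP eP] := iP; have [leQ oQ eQ] := iQ.
have [|t2 [a [t1 [perm_P Ca nt2 rt1 [st2 st1 t2J]]]]] :=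
  split_arrangement uP oP leP JP lJ (C := C); first by move=> c cP /(CP c cP)[].
have [|x2 [b [y1 [perm_Q Cb nx2 ry1 [sx2 sy1 x2I]]]]] :=
  split_arrangement uQ oQ leQ IQ lI (C := C); first by move=> c cQ /(CQ c cQ)[].
have [inP inQ] := (perm_mem perm_P, perm_mem perm_Q).
have [subt2 subt1] : {subset t2 <= P} /\ {subset a :: t1 <= P}.
  by split=> x xs; rewrite -inP mem_cat xs ?orbT.
have [subx2 suby1] : {subset x2 <= Q} /\ {subset b :: y1 <= Q}.
  by split=> x xs; rewrite -inQ mem_cat xs ?orbT.
have [] : [/\ uniq t2, uniq (a :: t1) & {in t2, forall x, x \notin a :: t1}].
  move: uP; rewrite -(perm_uniq perm_P) cat_uniq => /and3P[-> /hasPn h ->]; split=> //.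
  by move=> x; apply: contraL => /h.
move=> ut2 ut1 dt.
have [] : [/\ uniq x2, uniq (b :: y1) & {in x2, forall x, x \notin b :: y1}].
  move: uQ; rewrite -(perm_uniq perm_Q) cat_uniq => /and3P[-> /hasPn h ->]; split=> //.
  by move=> x; apply: contraL => /h.
(* [R1] joins the part of [Q] behind its cut, across [I] and the reversed link, to the part of [P]
   up to its cut; [R2] does the same with the roles exchanged. *)
move=> ux2 uy1 dx; pose R1 := x2 ++ I :: rev W ++ a :: t1; pose R2 := t2 ++ J :: W ++ b :: y1.
have [JW WI] : path e J W /\ e (last J W) I by apply/andP; rewrite -rcons_path.
(* For empty [W] the default of [head] makes this the edge between [I] and [J]. *)
have hJ : e (head I W) J.
  by rewrite e_sym; case: (W) JWI => /= [|w W' /andP[]//]; rewrite andbT.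
have aP : a \in P by rewrite subt1 ?mem_head.
have bQ : b \in Q by rewrite suby1 ?mem_head.
(* Vertices of [a :: t1] end by [rP J] and those of [x2] are outside [C], whereas a common vertex
   outside [C] reaches beyond [rP J]. *)
have disj x : x \in a :: t1 -> x \in x2 -> False.
  move=> xt xx; have [xP xQ] := (subt1 _ xt, subx2 _ xx).
  have [_ nCx] := nx2 _ xx; have := PQ _ xP xQ; rewrite (negbTE nCx) /= => /andP[+ _].
  by rewrite ltnNge rt1.
have disj' x : x \in b :: y1 -> x \in t2 -> False.
  move=> xy xt; have [xP xQ] := (subt2 _ xt, suby1 _ xy).
  have [_ nCx] := nt2 _ xt; have := PQ _ xP xQ; rewrite (negbTE nCx) /= => /andP[_].
  by rewrite ltnNge ry1.
have gR1 : graph_path e R1.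
  split; first by rewrite /R1; case: (x2).
    apply: uniq_join => //; rewrite ?rev_uniq ?mem_rev //.
    - by apply/negP => /nx2[]; rewrite eqxx.
    - by apply/negP => /WPQ[_]; rewrite IQ.
    - by apply/negP => /subt1; apply/negP.
    - move=> x xx; rewrite mem_rev; split; apply/negP; last by move/disj; apply.
      by move/WPQ => [_]; rewrite subx2.
    - by move=> x; rewrite mem_rev => /WPQ[xP _]; apply: contra xP => /subt1.
  apply: sorted_join.
  - exact: interval_path_sorted iQ _ _ _.
  - move=> t x def_x; apply: eQ (x2I _ _ def_x) => //.
      by apply: subx2; rewrite def_x mem_rcons mem_head.
    by have [] // := nx2 x; rewrite def_x mem_rcons mem_head.
  - have := rev_path e J (rcons W I); rewrite last_rcons belast_rcons rev_cons.
    rewrite (@eq_path _ _ e) => [|x y]; last exact: e_sym.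
    by rewrite JWI rcons_path => /andP[].
  - have -> : last I (rev W) = head I W by case: (W) => //= w W'; rewrite rev_cons last_rcons.
    by case: Ca => [/(CP _ aP)[]|->].
  - exact: interval_path_sorted iP _ _ _.
have gR2 : graph_path e R2.
  split; first by rewrite /R2; case: (t2).
    apply: uniq_join => //.
    - by apply/negP => /nt2[]; rewrite eqxx.
    - by apply/negP => /WPQ[]; rewrite JP.
    - by apply/negP => /suby1; apply/negP.
    - move=> x xt; split; apply/negP; last by move/disj'; apply.
      by move/WPQ => []; rewrite subt2.
    - by move=> x /WPQ[_ xQ]; apply: contra xQ => /suby1.
  apply: sorted_join => //.
  - exact: interval_path_sorted iP _ _ _.
  - move=> t x def_x; apply: eP (t2J _ _ def_x) => //.
      by apply: subt2; rewrite def_x mem_rcons mem_head.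
    by have [] // := nt2 x; rewrite def_x mem_rcons mem_head.
  - by case: Cb => [/(CQ _ bQ)[]|->].
  - exact: interval_path_sorted iQ _ _ _.
have := maxP _ gR1; have := maxQ _ gR2; have := maxP _ gR2.
have := perm_size perm_P; have := perm_size perm_Q.
rewrite /R1 /R2 !size_cat /= !size_cat /= size_rev.
move: (size P) (size Q) (size x2) (size y1) (size t1) (size t2) (size W).
by clear=> *; arith.
Qed.

End Exchange.

(** * Arcs on the circle cut at a point *)

Section CutCircle.
Variables (W : finType) (N : nat) (o : W).
Implicit Types (pos : W -> nat) (A B K : {set W}) (l r : nat).

Definition convex pos A :=
  forall x y z, x \in A -> z \in A -> pos x <= pos y <= pos z -> y \in A.

(* The circle is cut open at [o]: an arc through [o] becomes the complement of
   an interval. *)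
Definition cut_arc pos A := convex pos (if o \in A then ~: A else A).

Definition mirror pos w := N - pos w.

(** The values [0] and [N] stay free for the two sides of the cut. *)
Definition in_range pos := forall w, 0 < pos w < N.

(* [l, r] spans a connected component of the arc [A] on the cut circle; a
   component containing the cut point is extended to [0] or [N]. *)
Record piece pos A l r : Prop := Piece {
  piece_le : l <= r;
  piece_N : r <= N;
  piece_solid : forall t, l <= pos t <= r -> t \in A;
  piece_left : o \in A /\ l = 0 \/ exists2 t, t \in A & pos t = l;
  piece_right : o \in A /\ r = N \/ exists2 t, t \in A & pos t = r;
  piece_wrap : o \in A -> l = 0 \/ r = N;
  piece_all : o \notin A -> forall t, t \in A -> l <= pos t <= r;
  piece_lgap : forall t, t \in A -> pos t < l -> exists2 s, s \notin A & pos t < pos s < l;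
  piece_rgap : forall t, t \in A -> r < pos t -> exists2 s, s \notin A & r < pos s < pos t }.

Lemma in_range_mirror pos : in_range pos -> in_range (mirror pos).
Proof. by move=> h w; rewrite /mirror; have := h w; arith. Qed.

Lemma cut_arc_mirror pos A : in_range pos -> cut_arc pos A -> cut_arc (mirror pos) A.
Proof.
move=> h cA x y z xA zA; rewrite /mirror => xyz; apply: (cA z y x) => //.
by have := h x; have := h y; have := h z; arith.
Qed.

Lemma piece_mirror pos A l r : in_range pos ->
  piece pos A l r -> piece (mirror pos) A (N - r) (N - l).
Proof.
move=> h [p1 p2 p3 p4 p5 p6 p7 p8 p9]; rewrite /mirror; split.
- arith.
- arith.
- by move=> t ht; apply: p3; have := h t; arith.
- by case: p5 => [[oA ->]|[t tA <-]]; [left; split=> //; arith | right; exists t].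
- by case: p4 => [[oA ->]|[t tA <-]]; [left; split=> //; arith | right; exists t].
- by case/p6 => ->; [right|left]; arith.
- by move=> oA t /(p7 oA); have := h t; arith.
- move=> t tA ht; have [|s sA hs] := p9 t tA; first by have := h t; arith.
  by exists s => //; have := h t; have := h s; arith.
- move=> t tA ht; have [|s sA hs] := p8 t tA; first by have := h t; arith.
  by exists s => //; have := h t; have := h s; arith.
Qed.

Section Pos.
Variable pos : W -> nat.
Hypothesis posN : in_range pos.

Lemma cut_arc_in A x y z : cut_arc pos A -> o \notin A ->
  x \in A -> z \in A -> pos x <= pos y <= pos z -> y \in A.
Proof. by rewrite /cut_arc => cA /negbTE oA; move: cA; rewrite oA; apply. Qed.

Lemma cut_arc_out A x y z : cut_arc pos A -> o \in A ->
  x \notin A -> z \notin A -> pos x <= pos y <= pos z -> y \notin A.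
Proof.
rewrite /cut_arc => cA oA; move: cA; rewrite oA => cA xA zA h.
by have := cA x y z; rewrite !inE => /(_ xA zA h).
Qed.

Lemma cut_arc_eqpos A x y : cut_arc pos A -> pos x = pos y -> (x \in A) = (y \in A).
Proof.
move=> cA eq_xy; have [oA|oA] := boolP (o \in A).
  apply/idP/idP; apply: contraLR => h.
    by apply: (cut_arc_out (x := y) (z := y)); rewrite // eq_xy leqnn.
  by apply: (cut_arc_out (x := x) (z := x)); rewrite // eq_xy leqnn.
apply/idP/idP => h.
  by apply: (cut_arc_in (x := x) (z := x)); rewrite // eq_xy leqnn.
by apply: (cut_arc_in (x := y) (z := y)); rewrite // eq_xy leqnn.
Qed.

(** The larger left end lies in both pieces. If no point attains it, it is the cut side [0]; the
    other left end is then [0] too, and both arcs contain [o]. *)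
Lemma piece_overlap A B lA rA lB rB : piece pos A lA rA -> piece pos B lB rB ->
  lA <= rB -> lB <= rA -> exists2 w, w \in A & w \in B.
Proof.
move=> pA pB hA hB.
wlog le_l : A B lA rA lB rB pA pB hA hB / lB <= lA => [H|].
  case/orP: (leq_total lB lA) => hl; first exact: (H A B lA rA lB rB).
  by have [w wB wA] := H B A _ _ _ _ pB pA hB hA hl; exists w.
case: (piece_left pA) => [[oA lA0]|[t tA tl]].
  case: (piece_left pB) => [[oB _]|[t _ tl]]; first by exists o.
  by have := posN t; arith.
by exists t => //; apply: (piece_solid pB); arith.
Qed.

End Pos.

(** If [o] is outside [A], the whole arc is the piece. Otherwise a point [s] of [K] outside [A]
    separates the two sides of [A]; the points off [K] form an interval missing [s], so those in [A]
    are all on one side. *)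
Lemma piece_exists pos A K x : in_range pos -> cut_arc pos A -> cut_arc pos K ->
    o \in K -> x \in A -> x \notin K -> ~~ (K \subset A) ->
  exists l r, piece pos A l r /\
    forall t, t \in A -> t \notin K -> l <= pos t <= r.
Proof.
move=> posN cA cK oK xA xK /subsetPn[s sK sA].
have [oA|oA] := boolP (o \in A); last first.
  case: (@arg_minnP W x (mem A) pos xA) => tl tlA tlmin.
  case: (@arg_maxnP W x (mem A) pos xA) => tr trA trmax.
  have bound t : t \in A -> pos tl <= pos t <= pos tr.
    by move=> tA; apply/andP; split; [apply: tlmin | apply: trmax].
  exists (pos tl), (pos tr); split; last by move=> t tA _; apply: bound.
  split.
  - by have := bound _ trA; arith.
  - by have := posN tr; arith.
  - by move=> t; apply: cut_arc_in cA oA tlA trA.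
  - by right; exists tl.
  - by right; exists tr.
  - by rewrite (negbTE oA).
  - by move=> _.
  - by move=> t /bound; arith.
  - by move=> t /bound; arith.
have xs : pos x <> pos s.
  by move=> /(cut_arc_eqpos cA); rewrite xA (negbTE sA).
wlog {xs} lt_xs : pos posN cA cK / pos x < pos s => [H|].
  have [|le_sx] := ltnP (pos x) (pos s); first exact: H.
  have [||||l [r [plr hlr]]] := H (mirror pos).
  - exact: in_range_mirror.
  - exact: cut_arc_mirror.
  - exact: cut_arc_mirror.
  - by rewrite /mirror; have := posN x; have := posN s; arith.
  have lr := piece_le plr; have rN := piece_N plr.
  exists (N - r), (N - l); split; last first.
    by move=> t tA tK; have := hlr t tA tK; rewrite /mirror; have := posN t; arith.
  suff -> : pos = mirror (mirror pos) by apply: piece_mirror => //; apply: in_range_mirror.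
  by apply: boolp.funext => w; rewrite /mirror; have := posN w; arith.
have not_between t : t \in A -> t \notin K -> pos t < pos s.
  move=> tA tK; rewrite ltnNge; apply/negP => le_st.
  have : s \notin K by apply: (cut_arc_out cK oK xK tK); rewrite (ltnW lt_xs).
  by rewrite sK.
have xA' : (x \in A) && (pos x < pos s) by rewrite xA.
(* The piece runs from the cut to the last point of [A] before [s]. *)
case: (@arg_maxnP W x (fun t => (t \in A) && (pos t < pos s)) pos xA').
move=> tr /andP[trA tr_s] trmax; have {}trmax t : t \in A -> pos t < pos s -> pos t <= pos tr.
  by move=> tA ts; apply: trmax; rewrite tA.
exists 0, (pos tr); split; last by move=> t tA tK; rewrite leq0n trmax ?not_between.
split=> //.
- by have := posN tr; arith.
- move=> t /andP[_ ht]; apply: contraLR trA => tA.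
  by apply: (cut_arc_out cA oA tA sA); arith.
- by left.
- by right; exists tr.
- by left.
- by rewrite oA.
- move=> t tA ht; exists s => //; rewrite tr_s /= ltn_neqAle; apply/andP; split.
    by apply: contraNneq sA => /(cut_arc_eqpos cA) ->.
  by rewrite leqNgt; apply/negP => /(trmax _ tA); arith.
Qed.

End CutCircle.

(** * Linked maximal arcs *)

(* [J] and [I] are arcs through the cut point, [J] extending further to the
   right and [I] further to the left; [l, r] is the component of [A] that leaves
   [I], and [l', r'] the one that leaves [J]. *)
Lemma piece_cross (W : finType) N (o : W) pos (A I J : {set W}) x y l r l' r' rJ lI :
    in_range N pos -> cut_arc o pos I -> o \in I ->
    piece N o pos J 0 rJ -> piece N o pos I lI N ->
    piece N o pos A l r -> (forall t, t \in A -> t \notin I -> l <= pos t <= r) ->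
    piece N o pos A l' r' -> (forall t, t \in A -> t \notin J -> l' <= pos t <= r') ->
    x \in A -> x \notin I -> y \in A -> y \notin J -> ~~ (I \subset A) -> r <= rJ ->
  [/\ o \in A, l = 0, r' = N & lI <= l'].
Proof.
move=> posN cI oI pJ pI pA hA pA' hA' xA xI yA yJ /subsetPn[t tI tA] le_r.
have Jy : rJ < pos y.
  by rewrite ltnNge; apply: contra yJ => h; apply: (piece_solid pJ).
have yN := posN y.
(* Without [o] the piece from [l] to [r] would be all of [A] and contain [y], which lies beyond
   [rJ]. *)
have oA : o \in A.
  by apply: contraT => oA; have := piece_all pA oA yA; arith.
have l0 : l = 0 by case: (piece_wrap pA oA) => // rN; arith.
have [|s sA hs] := piece_rgap pA yA; first by arith.
have ly := hA' _ yA yJ.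
have sl : pos s < l'.
  by rewrite ltnNge; apply: contra sA => h; apply: (piece_solid pA'); arith.
have rN : r' = N by case: (piece_wrap pA' oA) => // l0'; arith.
split=> //; rewrite leqNgt; apply/negP => lt_l.
(* Otherwise [t], a point of [I] outside [A], lies between [r] and [l'], hence left of [lI], with
   [x] and another point off [I] on either side of it; but the points off [I] form an interval. *)
have tN := posN t.
have tl : pos t < l'.
  by rewrite ltnNge; apply: contra tA => h; apply: (piece_solid pA'); arith.
have tr : r < pos t.
  by rewrite ltnNge; apply: contra tA => h; apply: (piece_solid pA); arith.
have [|s2 s2I hs2] := piece_lgap pI tI; first by arith.
have hx := hA _ xA xI.
have /negP[] // : t \notin I by apply: (cut_arc_out cI oI xI s2I); arith.
Qed.

Section Core.
Variables (V W : finType) (e : rel V) (arc : V -> {set W}).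
Implicit Types (P Q S : seq V) (u v w a b I J : V) (x y t : W).
Hypothesis simple_e : simple_graph e.
Hypothesis adj : forall u v, u != v -> e u v = (arc u :&: arc v != set0).
Hypothesis cuttable : forall o : W, exists N pos,
  in_range N pos /\ forall v, cut_arc o pos (arc v).

Lemma meetP u v : u != v -> reflect (exists2 x, x \in arc u & x \in arc v) (e u v).
Proof.
move=> ne_uv; rewrite adj //; apply: (iffP (set0Pn _)) => [[x]|[x xu xv]].
  by rewrite inE => /andP[]; exists x.
by exists x; rewrite inE xu.
Qed.

Definition maximal_arc v := [forall u, (arc v \subset arc u) ==> (arc u \subset arc v)].

Definition edge_point P x :=
  exists s1 a b s2, [/\ P = s1 ++ a :: b :: s2, x \in arc a & x \in arc b].

Lemma edge_point_mem P x v : longest_path e P -> edge_point P x -> x \in arc v -> v \in P.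
Proof.
move=> [[nP uP sP] maxP] [s1 [a [b [s2 [def_P xa xb]]]]] xv; apply: contraT => vP.
suff /maxP : graph_path e (s1 ++ a :: v :: b :: s2).
  by rewrite def_P !size_cat /=; arith.
move: vP; rewrite def_P mem_cat !inE !negb_or => /and4P[vs1 va vb vs2].
split; first by case: (s1).
  move: uP; rewrite def_P -!(cat1s _ (_ :: _)) !catA => uP.
  rewrite (perm_uniq (_ : perm_eq _ (v :: s1 ++ a :: b :: s2))); last first.
    by apply/permP => p; rewrite /= !count_cat /=; arith.
  rewrite cons_uniq mem_cat !inE !negb_or vs1 va vb vs2 /=.
  by move: uP; rewrite -!catA.
move: sP; rewrite def_P.
have eav : e a v by apply/meetP; [rewrite eq_sym | exists x].
have evb : e v b by apply/meetP => //; exists x.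
case: s1 {def_P vs1} => /= [|y s1]; first by rewrite eav evb => /andP[].
by rewrite !cat_path /= eav evb => /and3P[-> -> /andP[]].
Qed.

(** With at least two vertices on [P], [a] has a neighbour along the path. *)
Lemma edge_point_exists P a : graph_path e P -> 1 < size P -> a \in P ->
  exists2 x, x \in arc a & edge_point P x.
Proof.
move=> [_ uP sP] szP aP; case/splitPr: aP uP sP szP => p1 [|b p2].
  case/lastP: p1 => [|p b] // uP sP _.
  rewrite cat_rcons in uP sP *.
  have ne := uniq_consecutive uP; have /(meetP ne)[x xb xa] := sorted_consecutive sP.
  by exists x => //; exists p, b, a, [::].
move=> uP sP _; have ne := uniq_consecutive uP.
have /(meetP ne)[x xa xb] := sorted_consecutive sP.
by exists x => //; exists p1, a, b, p2.
Qed.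

(** By maximality [arc K] would equal [arc a] and contain an edge point of [P], which forces [K]
    onto [P]. *)
Lemma maximal_notsub P K a : longest_path e P -> 1 < size P -> maximal_arc K ->
  K \notin P -> a \in P -> ~~ (arc K \subset arc a).
Proof.
move=> lP szP /forallP/(_ a)/implyP maxK KP aP; apply/negP => /maxK/subsetP sub.
have [x xa xP] := edge_point_exists lP.1 szP aP.
by move: KP; rewrite (edge_point_mem lP xP (sub _ xa)).
Qed.

Lemma interval_path_pieces o N pos P l r : in_range N pos -> graph_path e P ->
    {in P, forall v, piece N o pos (arc v) (l v) (r v)} ->
    {in P, forall v x, x \in arc v -> edge_point P x -> l v <= pos x <= r v} ->
  interval_path e l r P.
Proof.
move=> posN [_ uP sP] pP hP; split.
- by move=> v /pP/piece_le.
- apply: sorted_pairs => s1 a b s2 def_P.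
  have ne : a != b by apply: (@uniq_consecutive _ s1 s2); rewrite -def_P.
  have /(meetP ne)[x xa xb] : e a b.
    by apply: (@sorted_consecutive _ _ s1 _ _ s2); rewrite -def_P.
  have xP : edge_point P x by exists s1, a, b, s2.
  have := hP a _ x xa xP; have := hP b _ x xb xP.
  rewrite !def_P !mem_cat !inE !eqxx !orbT /overlap => /(_ isT) h1 /(_ isT) h2.
  arith.
- move=> u v uP' vP ne /andP[h1 h2]; apply/meetP => //.
  exact: piece_overlap (pP _ uP') (pP _ vP) h1 h2.
Qed.

Lemma pieces_exist o N pos K (D : pred V) :
    in_range N pos -> (forall v, cut_arc o pos (arc v)) -> o \in arc K ->
    (forall v, D v -> exists2 x, x \in arc v & x \notin arc K) ->
    (forall v, D v -> ~~ (arc K \subset arc v)) ->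
  exists l r, forall v, D v -> piece N o pos (arc v) (l v) (r v) /\
    forall x, x \in arc v -> x \notin arc K -> l v <= pos x <= r v.
Proof.
move=> posN cut oK outK notK.
have : forall v, exists lr : nat * nat, D v -> piece N o pos (arc v) lr.1 lr.2 /\
    forall x, x \in arc v -> x \notin arc K -> lr.1 <= pos x <= lr.2.
  move=> v; have [Dv|] := boolP (D v); last by exists (0, 0).
  have [x xv xK] := outK v Dv.
  have [l [r h]] := piece_exists posN (cut v) (cut K) oK xv xK (notK v Dv).
  by exists (l, r).
by case/fin_all_exists => f hf; exists (fun v => (f v).1), (fun v => (f v).2).
Qed.

Lemma exists_outside P K v : longest_path e P -> 1 < size P -> K \notin P -> v \in P ->
  exists2 x, x \in arc v & x \notin arc K.
Proof.
move=> lP szP KP vP; have [x xv xP] := edge_point_exists lP.1 szP vP.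
by exists x => //; apply: contra KP; apply: edge_point_mem.
Qed.

(** The circle is cut at a common point [o] of [I] and [J]. [P] is read through the pieces leaving
    [I], and [Q], mirrored, through those leaving [J]; the link is the single edge between [I] and
    [J]. *)
Lemma core_adjacent P Q I J : longest_path e P -> longest_path e Q ->
    1 < size P -> 1 < size Q -> maximal_arc J -> maximal_arc I ->
    J \in P -> J \notin Q -> I \in Q -> I \notin P -> e J I ->
  False.
Proof.
move=> lP lQ szP szQ maxJ maxI JP JQ IQ IP eJI.
have neJI : J != I by apply: contraNneq JQ => ->.
have [o oJ oI] := meetP neJI eJI.
have [N [pos [posN cut]]] := cuttable o.
have [x0 x0J x0P] := edge_point_exists lP.1 szP JP.
have [y0 y0I y0Q] := edge_point_exists lQ.1 szQ IQ.
have outP x : edge_point P x -> x \notin arc I.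
  by move=> xP; apply: contra IP; apply: edge_point_mem.
have outQ x : edge_point Q x -> x \notin arc J.
  by move=> xQ; apply: contra JQ; apply: edge_point_mem.
have neq0 : pos x0 <> pos y0.
  by move=> /(cut_arc_eqpos (cut J)); rewrite x0J (negbTE (outQ _ y0Q)).
wlog {neq0} lt0 : P Q I J lP lQ szP szQ maxJ maxI JP JQ IQ IP eJI neJI oJ oI
    x0 x0J x0P y0 y0I y0Q outP outQ / pos x0 < pos y0 => [H|].
  have [|] := ltnP (pos x0) (pos y0); first by apply: (H P Q I J).
  move=> le.
  apply: (H Q P J I lQ lP szQ szP maxI maxJ IQ IP JP JQ _ _ oI oJ y0 y0I y0Q x0) => //.
  - by rewrite simple_e.1.
  - by rewrite eq_sym.
  - by rewrite ltn_neqAle le andbT; apply/eqP => /esym.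
have [l [r hP]] := pieces_exist posN cut oI
  (fun v => @exists_outside P I v lP szP IP) (fun v => maximal_notsub lP szP maxI IP).
have [l' [r' hQ]] := pieces_exist posN cut oJ
  (fun v => @exists_outside Q J v lQ szQ JQ) (fun v => maximal_notsub lQ szQ maxJ JQ).
have y0J := outQ _ y0Q; have x0I := outP _ x0P.
have [N0 N1] := (posN x0, posN y0).
have [pJ cJ] := hP J JP; have [pI cI] := hQ I IQ.
have := cJ _ x0J x0I; have := cI _ y0I y0J => hI hJ.
have rJ : r J < pos y0.
  by rewrite ltnNge; apply: contra y0J => h; apply: (piece_solid pJ); arith.
have lI : pos x0 < l' I.
  by rewrite ltnNge; apply: contra x0I => h; apply: (piece_solid pI); arith.
(* [J] occupies the side [0] of the cut and [I] the side [N]. *)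
have lJ0 : l J = 0 by case: (piece_wrap pJ oJ) => // ?; arith.
have rIN : r' I = N by case: (piece_wrap pI oI) => // ?; arith.
rewrite lJ0 in pJ; rewrite rIN in pI.
have posN' := in_range_mirror posN.
have cross z : z \in P -> z \in Q -> r z <= r J ->
    [/\ o \in arc z, l z = 0, r' z = N & l' I <= l' z].
  move=> zP zQ; have [x xz xP] := edge_point_exists lP.1 szP zP.
  have [y yz yQ] := edge_point_exists lQ.1 szQ zQ.
  have [pz cz] := hP z zP; have [pz' cz'] := hQ z zQ.
  by apply: (piece_cross posN (cut I) oI pJ pI pz cz pz' cz' xz (outP _ xP) yz (outQ _ yQ));
    apply: maximal_notsub lP szP maxI IP zP.
have cross' z : z \in P -> z \in Q -> l' I <= l' z -> r z <= r J.
  move=> zP zQ hz; have [x xz xP] := edge_point_exists lP.1 szP zP.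
  have [y yz yQ] := edge_point_exists lQ.1 szQ zQ.
  have [pz cz] := hP z zP; have [pz' cz'] := hQ z zQ.
  have qI := piece_mirror posN pI; rewrite subnn in qI.
  have qJ := piece_mirror posN pJ; rewrite subn0 in qJ.
  have mir (i j : nat) t : i <= pos t <= j -> N - j <= mirror N pos t <= N - i.
    by rewrite /mirror; arith.
  have [||||_ _ _] := piece_cross posN' (cut_arc_mirror posN (cut J)) oJ qI qJ
    (piece_mirror posN pz') _ (piece_mirror posN pz) _ yz (outQ _ yQ) xz (outP _ xP).
  - by move=> t tz tJ; apply/mir/cz'.
  - by move=> t tz tI; apply/mir/cz.
  - exact: maximal_notsub lQ szQ maxJ JQ zQ.
  - arith.
  have := piece_N pz; have := piece_N pJ; arith.
(* By [cross] the vertices of [C] contain [o], hence meet both [I] and [J]. By [cross'] every other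
   common vertex reaches to the right of [r J] and to the left of [l' I]. *)
pose C := [pred z | [&& z \in P, z \in Q & r z <= r J]].
apply: (@exchange V e simple_e P Q [::] I J l r
  (fun v => N - r' v) (fun v => N - l' v) C) => //=.
- by rewrite eJI.
- apply: (interval_path_pieces (o := o) posN lP.1) => v vP; have [pv cv] := hP v vP => //.
  by move=> x xv xP; apply: cv => //; apply: outP.
- apply: (interval_path_pieces (o := o) posN' lQ.1) => [v /hQ[p _]|v vQ x xv xQ].
    exact: piece_mirror.
  have [_ h] := hQ v vQ; have := h x xv (outQ _ xQ); rewrite /mirror; arith.
- by move=> x xP; rewrite lJ0.
- by move=> x xQ; rewrite rIN subnn.
- move=> c cP /and3P[_ cQ rc]; have [oc lc _ _] := cross c cP cQ rc; split=> //.
    by move=> x _; rewrite lc.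
  by apply/meetP; [apply: contraNneq IP => -> | exists o].
- move=> c cQ /and3P[cP _ rc]; have [oc _ rc' lc] := cross c cP cQ rc; split=> //.
  + by move=> x _; rewrite rc' subnn.
  + arith.
  by apply/meetP; [apply: contraNneq JQ => -> | exists o].
- move=> z zP zQ; rewrite zP zQ /=; case: leqP => //= rz.
  have : l' z < l' I by rewrite ltnNge; apply/negP => /(cross' z zP zQ); arith.
  have [pz _] := hQ z zQ; have := piece_N pz; have := piece_le pz.
  have := piece_le pI; arith.
Qed.

(** An arc missing both ends of the window cannot have points inside and outside it, and a common
    point with [u] puts [v] outside. *)
Lemma avoid_between o pos u v x y : (forall v, cut_arc o pos (arc v)) ->
    x \notin arc v -> y \notin arc v -> (exists2 t, t \in arc u & t \in arc v) ->
    (forall t, t \in arc u -> ~~ (pos x <= pos t <= pos y)) ->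
  forall t, t \in arc v -> ~~ (pos x <= pos t <= pos y).
Proof.
move=> cut xv yv [t tu tv] hu s sv; apply/negP => hs; have ht := hu t tu.
have [ov|ov] := boolP (o \in arc v).
  by have := cut_arc_out (cut v) ov xv yv hs; rewrite sv.
have [lt|le] := ltnP (pos t) (pos x).
  by move: xv; rewrite (cut_arc_in (cut v) ov tv sv) //; arith.
by move: yv; rewrite (cut_arc_in (cut v) ov sv tv) //; arith.
Qed.

Lemma consecutive_propagate (B : V -> Prop) P u :
    (forall s1 a b s2, P = s1 ++ a :: b :: s2 -> B a <-> B b) -> u \in P -> B u ->
  {in P, forall v, B v}.
Proof.
case: P => // a P hB uP Bu.
suff hP : {in a :: P, forall v, B v <-> B a}.
  by move=> v vP; apply/(hP v vP)/(hP u uP).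
elim: P a hB {u uP Bu} => [|b P IH] a hB v; first by rewrite inE => /eqP->.
rewrite inE => /orP[/eqP->//|vP].
have -> : B a <-> B b by apply: (hB [::] a b P).
by apply: IH => // s1 c d s2 def; apply: (hB (a :: s1) c d s2); rewrite def.
Qed.

(** As [k] is on neither path, one cut at a point of [J] and [k] and one family of pieces serve
    both. Edge points of [P] lie left of [I], those of [Q] right of [J]; a common vertex has both
    kinds and so reaches beyond [J] and [I], which leaves the class [C] of [exchange] empty. *)
Lemma core_chain P Q I J k S : longest_path e P -> longest_path e Q ->
    1 < size P -> 1 < size Q -> maximal_arc J -> maximal_arc I -> maximal_arc k ->
    J \in P -> J \notin Q -> I \in Q -> I \notin P ->
    uniq (k :: S) -> {in k :: S, forall w, w \notin P /\ w \notin Q} ->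
    path e J (k :: rcons S I) ->
  False.
Proof.
move=> lP lQ szP szQ maxJ maxI maxk JP JQ IQ IP uS SPQ path_S.
have [kP kQ] := SPQ k (mem_head _ _).
have /andP[eJk _] := path_S.
have neJk : J != k by apply: contraNneq kP => <-.
have [o oJ ok] := meetP neJk eJk.
have [N [pos [posN cut]]] := cuttable o.
have [x0 x0J x0P] := edge_point_exists lP.1 szP JP.
have [y0 y0I y0Q] := edge_point_exists lQ.1 szQ IQ.
have outP x v : edge_point P x -> v \notin P -> x \notin arc v.
  by move=> xP; apply: contra; apply: edge_point_mem.
have outQ x v : edge_point Q x -> v \notin Q -> x \notin arc v.
  by move=> xQ; apply: contra; apply: edge_point_mem.
have [s sk sJ] := subsetPn (maximal_notsub lP szP maxk kP JP).
have neq0 : pos x0 <> pos s.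
  by move=> /(cut_arc_eqpos (cut J)); rewrite x0J (negbTE sJ).
wlog {neq0} lt0 : pos posN cut / pos x0 < pos s => [H|].
  have [|le] := ltnP (pos x0) (pos s); first exact: (H pos).
  apply: (H _ (in_range_mirror posN)) => [v|]; first exact: cut_arc_mirror.
  by rewrite /mirror; have := posN x0; have := posN s; arith.
have [l [r hlr]] : exists l r, forall v, (v \in P) || (v \in Q) ->
    piece N o pos (arc v) (l v) (r v) /\
    forall x, x \in arc v -> x \notin arc k -> l v <= pos x <= r v.
  apply: pieces_exist => // v /orP[] h.
  - exact: exists_outside lP szP kP h.
  - exact: exists_outside lQ szQ kQ h.
  - exact: maximal_notsub lP szP maxk kP h.
  - exact: maximal_notsub lQ szQ maxk kQ h.
have hP v : v \in P -> piece N o pos (arc v) (l v) (r v) /\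
    forall x, x \in arc v -> edge_point P x -> l v <= pos x <= r v.
  move=> vP; have [|p h] := hlr v; first by rewrite vP.
  by split=> // x xv xP; apply: h => //; apply: outP.
have hQ v : v \in Q -> piece N o pos (arc v) (l v) (r v) /\
    forall x, x \in arc v -> edge_point Q x -> l v <= pos x <= r v.
  move=> vQ; have [|p h] := hlr v; first by rewrite vQ orbT.
  by split=> // x xv xQ; apply: h => //; apply: outQ.
have [pJ cJ] := hP J JP; have [pI cI] := hQ I IQ.
have cJ0 := cJ _ x0J x0P; have cI0 := cI _ y0I y0Q.
have [Nx0 Ns] := (posN x0, posN s).
have rJ : r J < pos s.
  by rewrite ltnNge; apply: contra sJ => h; apply: (piece_solid pJ); arith.
have lJ0 : l J = 0 by case: (piece_wrap pJ oJ) => // ?; arith.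
have rightJ y : edge_point Q y -> r J < pos y.
  move=> yQ; rewrite ltnNge; apply: contra (outQ _ _ yQ JQ) => h.
  by apply: (piece_solid pJ); rewrite lJ0.
have y0r := rightJ _ y0Q.
have x0I : x0 \notin arc I by apply: outP.
have lI : pos x0 < l I.
  by rewrite ltnNge; apply: contra x0I => h; apply: (piece_solid pI); arith.
(* If [I] contains [o], its piece extends to [N]. If not, an arc of [P] with edge points on both
   sides of [I] would contain [arc I], against maximality, so the side is inherited along [P] from
   [J]. *)
have leftI x v : v \in P -> x \in arc v -> edge_point P x -> pos x < l I.
  move=> vP xv xP.
  have outside t : edge_point P t -> pos t < l I \/ r I < pos t.
    move=> tP; have [|le1] := ltnP (pos t) (l I); first by left.
    right; rewrite ltnNge; apply: contra (outP _ _ tP IP) => h.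
    by apply: (piece_solid pI); rewrite le1.
  have [oI|oI] := boolP (o \in arc I).
    case: (outside x xP) => //; case: (piece_wrap pI oI) => [|->]; first arith.
    by have := posN x; arith.
  have same u t t' : u \in P -> t \in arc u -> edge_point P t -> pos t < l I ->
      t' \in arc u -> edge_point P t' -> pos t' < l I.
    move=> uP tu tP lt_t t'u t'P; case: (outside t' t'P) => // gt_t'.
    have [pu cu] := hP u uP; have := cu _ tu tP; have := cu _ t'u t'P.
    move=> ct' ct; have /negP[] := maximal_notsub lP szP maxI IP uP.
    apply/subsetP => z zI; apply: (piece_solid pu).
    by have := piece_all pI oI zI; arith.
  pose B u := exists2 t, t \in arc u & edge_point P t /\ pos t < l I.
  suff [t tv [tP lt_t]] : B v by apply: same vP tv tP lt_t xv xP.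
  apply: (@consecutive_propagate B P J _ JP _ v vP); last by exists x0.
  move=> s1 a b s2 def_P.
  have [aP bP] : a \in P /\ b \in P.
    by rewrite def_P !mem_cat !inE !eqxx !orbT.
  have ne : a != b by apply: (@uniq_consecutive _ s1 s2); rewrite -def_P; case: lP => [[]].
  have /(meetP ne)[z za zb] : e a b.
    by apply: (@sorted_consecutive _ _ s1 _ _ s2); rewrite -def_P; case: lP => [[]].
  have zP : edge_point P z by exists s1, a, b, s2.
  split=> [[t ta [tP lt_t]]|[t tb [tP lt_t]]]; exists z => //; split=> //.
    exact: same aP ta tP lt_t za zP.
  exact: same bP tb tP lt_t zb zP.
(* If an edge point [y] of [Q] on [v] were right of [I], all link arcs would miss the stretch from
   [x0] to [y]: [k] does since it contains [o], and [avoid_between] passes this along the link to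
   [I], which has [y0] in that stretch. *)
have rightI v : v \in Q -> l v <= r I.
  move=> vQ; have [y yv yQ] := edge_point_exists lQ.1 szQ vQ.
  have [_ cv] := hQ v vQ; have := cv _ yv yQ.
  have [|gt_y cy] := leqP (pos y) (r I); first arith.
  have oI : o \notin arc I.
    apply/negP => /(piece_wrap pI) [|eq_r]; first arith.
    by have := posN y; arith.
  have yI : y \notin arc I by apply: contraL gt_y => /(piece_all pI oI); arith.
  suff : forall t, t \in arc I -> ~~ (pos x0 <= pos t <= pos y).
    by move=> /(_ _ y0I); arith.
  have : forall t, t \in arc k -> ~~ (pos x0 <= pos t <= pos y).
    move=> t tk; apply/negP => ht.
    by have := cut_arc_out (cut k) ok (outP _ _ x0P kP) (outQ _ _ yQ kQ) ht; rewrite tk.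
  have : {in k :: S, forall w, x0 \notin arc w /\ y \notin arc w}.
    by move=> w /SPQ[wP wQ]; split; [apply: outP | apply: outQ].
  case/andP: path_S => _.
  elim: S {uS SPQ} k {kP kQ eJk neJk ok s sk sJ lt0 Ns rJ maxk hlr} => [|w S IH] k /=.
    case/andP=> kI _ _; apply: avoid_between => //.
    have [->|ne] := eqVneq k I; first by exists y0.
    exact: meetP ne kI.
  case/andP=> kw path_S hS hk; apply: IH path_S _ _.
    by move=> w' w'S; apply: hS; rewrite inE w'S orbT.
  have [xw yw] : x0 \notin arc w /\ y \notin arc w by apply: hS; rewrite !inE eqxx orbT.
  apply: avoid_between cut xw yw _ hk.
  have [eq_kw|ne] := eqVneq k w; last exact: meetP ne kw.
  by move: kw; rewrite eq_kw simple_e.2.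
apply: (@exchange V e simple_e P Q (k :: S) I J l r
  (fun v => N - r v) (fun v => N - l v) pred0) => //=.
- apply: (interval_path_pieces (o := o) posN lP.1) => v /hP[//].
- apply: (interval_path_pieces (o := o) (in_range_mirror posN) lQ.1).
    by move=> v /hQ[p _]; apply: piece_mirror.
  move=> v vQ x xv xQ; have [_ h] := hQ v vQ; have := h x xv xQ; rewrite /mirror; arith.
- by move=> x xP; rewrite lJ0.
- by move=> v /rightI; arith.
- move=> z zP zQ; have [x xz xP] := edge_point_exists lP.1 szP zP.
  have [y yz yQ] := edge_point_exists lQ.1 szQ zQ.
  have [pz cz] := hP z zP; have [_ cz'] := hQ z zQ.
  have := cz _ xz xP; have := cz' _ yz yQ; have := leftI x z zP xz xP; have := rightJ y yQ.
  have := piece_N pI; have := piece_le pI; arith.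
Qed.

End Core.

(** * Components of the maximal arcs off a path *)

Section Components.
Variables (V W : finType) (e : rel V) (arc : V -> {set W}).
Implicit Types (P Q S : seq V) (a b c u v w x y I J : V).
Hypothesis simple_e : simple_graph e.
Hypothesis connected_e : connected_graph e.
Hypothesis arc_neq0 : forall v, arc v != set0.
Hypothesis adj : forall u v, u != v -> e u v = (arc u :&: arc v != set0).
Hypothesis cuttable : forall o : W, exists N pos,
  in_range N pos /\ forall v, cut_arc o pos (arc v).

Local Notation maximal := (maximal_arc arc).

Definition max_adj u v := [&& maximal u, maximal v & e u v].

Definition max_adj_off P u v := [&& max_adj u v, u \notin P & v \notin P].

Lemma max_adj_sym : symmetric max_adj.
Proof. by move=> u v; rewrite /max_adj simple_e.1 andbCA. Qed.

Lemma max_adj_off_sym P : connect_sym (max_adj_off P).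
Proof.
by apply: sym_connect_sym => u v; rewrite /max_adj_off max_adj_sym [X in _ && X]andbC.
Qed.

Lemma maximal_above v : exists2 u, maximal u & arc v \subset arc u.
Proof.
case: (@arg_maxnP V v (fun u => arc v \subset arc u) (fun u => #|arc u|)) => // u vu umax.
exists u => //; apply/forallP => w; apply/implyP => uw.
have /eqP-> // : arc u == arc w by rewrite eqEcard uw; apply/umax/(subset_trans vu uw).
Qed.

Lemma max_adj_meet x y t : maximal x -> maximal y -> t \in arc x -> t \in arc y ->
  connect max_adj x y.
Proof.
move=> mx my tx ty; have [->|ne] := eqVneq x y; first exact: connect0.
apply: connect1; rewrite /max_adj mx my /= adj //.
by apply/set0Pn; exists t; rewrite inE tx.
Qed.

(** Each vertex of a path in [e] is replaced by a maximal arc above it; consecutive ones still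
    meet. *)
Lemma max_adj_connect x y : maximal x -> maximal y -> connect max_adj x y.
Proof.
move=> mx my; suff H a b : connect e a b -> forall x y, maximal x -> maximal y ->
    arc a \subset arc x -> arc b \subset arc y -> connect max_adj x y.
  exact: (H x y (connected_e.2 x y)).
case/connectP=> p; elim: p a => [|a' p IH] a /=.
  move=> _ -> {}x {}y {}mx {}my /subsetP ax /subsetP ay.
  have [t ta] := set0Pn _ (arc_neq0 a).
  exact: max_adj_meet mx my (ax t ta) (ay t ta).
case/andP=> eaa' path_p def_b {}x {}y {}mx {}my /subsetP ax by_.
have [z mz a'z] := maximal_above a'.
apply: connect_trans (IH a' path_p def_b z y mz my a'z by_).
have ne : a != a' by apply: contraTneq eaa' => <-; rewrite simple_e.2.
have [t ta ta'] := meetP adj ne eaa'.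
exact: max_adj_meet mx mz (ax t ta) (subsetP a'z t ta').
Qed.

Lemma connect_off P c u : connect (max_adj_off P) c u -> maximal c -> c \notin P ->
  maximal u /\ u \notin P.
Proof.
case/connectP=> p; elim/last_ind: p u => [|p w _] u; first by move=> _ ->.
rewrite rcons_path last_rcons => /andP[_ h] -> _ _.
by case/and3P: h => /and3P[_ mw _] _ wP.
Qed.

Lemma exit_component P c x : connect max_adj c x -> c \notin P -> x \in P ->
  exists u J, [/\ connect (max_adj_off P) c u, J \in P & max_adj u J].
Proof.
case/connectP=> p; elim: p c => [|w p IH] c /=.
  by move=> _ -> /negP.
case/andP=> cw path_p def_x cP xP; have [wP|wP] := boolP (w \in P).
  by exists c, w.
have [u [J [wu JP adj_uJ]]] := IH w path_p def_x wP xP; exists u, J; split=> //.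
by apply: connect_trans wu; apply: connect1; rewrite /max_adj_off cw cP.
Qed.

(** Induction on the number of vertices outside the component of [c]: either an exchange gives the
    contradiction, or the component off another longest path is strictly larger. *)
Lemma no_component n P c : (forall v, exists2 Q, longest_path e Q & v \notin Q) ->
    (forall Q, longest_path e Q -> 1 < size Q) ->
    longest_path e P -> maximal c -> c \notin P ->
    #|V| - #|[set v | connect (max_adj_off P) c v]| < n ->
  False.
Proof.
move=> missed sz; elim: n P c => // n IH P c lP mc cP lt_n.
have szP := sz P lP.
(* A maximal arc above a vertex of [P] contains an edge point of [P], hence is on [P]; so the
   component of [c] can be left. *)
have [x mx xP] : exists2 x, maximal x & x \in P.
  have [a aP] : exists a, a \in P.
    by case: (P) szP => // a P' _; exists a; rewrite mem_head.
  have [t ta tP] := edge_point_exists adj lP.1 szP aP.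
  have [x mx ax] := maximal_above a; exists x => //.
  exact (edge_point_mem adj lP tP (subsetP ax t ta)).
have [u [J [cu JP adj_uJ]]] := exit_component (max_adj_connect mc mx) cP xP.
have [mu uP] := connect_off cu mc cP.
have [_ mJ euJ] := and3P adj_uJ.
have [Q lQ JQ] := missed J; have szQ := sz Q lQ.
have [/existsP[z /andP[cz zQ]]|/existsPn offQ] :=
    boolP [exists z, connect (max_adj_off P) c z && (z \in Q)].
  have uz : connect (max_adj_off P) u z.
    by apply: connect_trans cz; rewrite max_adj_off_sym.
  have /connectP[p0 path_p0 def_z] := uz.
  (* A simple path from [u] to [z] is cut at its first vertex [I] on [Q]; the vertices before [I]
     are on neither path and form the link from [J]. *)
  case/shortenP: path_p0 def_z => p path_p uniq_p _ def_z.
  have hasQ : has (mem Q) (u :: p) by apply/hasP; exists z; rewrite // def_z mem_last.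
  have offP : {in u :: p, forall w, maximal w /\ w \notin P}.
    by move=> w wp; apply: connect_off mu uP; apply: path_connect path_p _ wp.
  have path_Jp : path e J (u :: p).
    rewrite /= simple_e.1 euJ; apply: sub_path path_p => a b.
    by case/and3P=> /and3P[].
  case/split_find: hasQ uniq_p offP path_Jp => I S0 rest IQ.
  rewrite -all_predC => /allP offQ uniq_p offP path_Jp.
  have {}path_Jp : path e J (rcons S0 I) by move: path_Jp; rewrite cat_path => /andP[].
  have [mI IP] : maximal I /\ I \notin P by apply: offP; rewrite mem_cat mem_rcons mem_head.
  case: S0 => [|k S] in uniq_p offP offQ path_Jp *.
    have eJI : e J I by move: path_Jp; rewrite /= andbT.
    exact: core_adjacent lP lQ szP szQ mJ mI JP JQ IQ IP eJI.
  have [mk _] : maximal k /\ k \notin P by apply: offP; rewrite inE eqxx.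
  apply: (core_chain simple_e adj cuttable lP lQ szP szQ mJ mI mk JP JQ IQ IP _ _ path_Jp).
    by move: uniq_p; rewrite cat_uniq rcons_uniq => /andP[/andP[]].
  move=> w wS; split; last exact: (offQ w wS).
  by have [] // := offP w; rewrite mem_cat mem_rcons inE wS orbT.
(* The component avoids [Q], so it stays connected off [Q], where [J] joins it through [u]. *)
have sub w : connect (max_adj_off P) c w -> connect (max_adj_off Q) c w.
  case/connectP=> p; elim/last_ind: p w => [|p w' IHp] w; first by move=> _ ->.
  rewrite rcons_path last_rcons => /andP[path_p adj_w] ->.
  apply: connect_trans (IHp _ path_p erefl) _; apply: connect1.
  have c_last : connect (max_adj_off P) c (last c p) by apply/connectP; exists p.
  have c_w' := connect_trans c_last (connect1 adj_w).
  have [adj_w' _ _] := and3P adj_w.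
  have := offQ (last c p); have := offQ w'; rewrite c_last c_w' /= => w'Q lQ'.
  by rewrite /max_adj_off adj_w' lQ' w'Q.
have cQ : c \notin Q by have := offQ c; rewrite connect0.
have uQ : u \notin Q by have := offQ u; rewrite cu.
apply: (IH Q c lQ mc cQ).
suff lt : #|[set v | connect (max_adj_off P) c v]| < #|[set v | connect (max_adj_off Q) c v]|.
  have le : #|[set v | connect (max_adj_off Q) c v]| <= #|V| by apply: max_card.
  by arith.
apply/proper_card/properP; split; first by apply/subsetP => w; rewrite !inE; apply: sub.
exists J; rewrite inE.
  apply: connect_trans (sub u cu) _; apply: connect1.
  by rewrite /max_adj_off adj_uJ uQ JQ.
by apply/negP => /connect_off/(_ mc cP)[_]; rewrite JP.
Qed.

Lemma longest_path_common : exists v, forall P, longest_path e P -> v \in P.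
Proof.
apply: boolp.contrapT => none.
have missed v : exists2 P, longest_path e P & v \notin P.
  apply: boolp.contrapT => nP; apply: none; exists v => P lP.
  by apply: contraT => vP; case: nP; exists P.
have [x0 _] : exists x0 : V, x0 \in V by apply/card_gt0P; exact: connected_e.1.
(* Without an edge, connectedness leaves only the vertex [x0], which no path could miss. *)
have sz Q : longest_path e Q -> 1 < size Q.
  move=> [[nQ _ _] maxQ]; rewrite ltnNge; apply/negP => le1.
  have no_edge a b : ~~ e a b.
    apply/negP => eab; have ne : a != b by apply: contraTneq eab => ->; rewrite simple_e.2.
    have : graph_path e [:: a; b] by split; rewrite //= ?inE ?ne ?eab.
    by move/maxQ => /=; arith.
  have all_x0 v : v = x0.
    have /connectP[[|a p] /=] := connected_e.2 x0 v; first by [].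
    by rewrite (negbTE (no_edge _ _)).
  have [P [[nP _ _] _]] := missed x0.
  by case: P nP => // a P _; rewrite (all_x0 a) mem_head.
have [c mc _] := maximal_above x0.
have [Q lQ cQ] := missed c.
exact: (no_component missed sz lQ mc cQ (ltnSn _)).
Qed.

End Components.

(** * Finitely many points on the circle *)

From mathcomp Require Import classical_sets reals trigo.
From mathcomp Require Import lra.

Import Order.TTheory GRing.Theory Num.Theory.
Local Open Scope ring_scope.

Section Angles.
Variable R : realType.
Implicit Types (a b s t x y : R) (n : int).

Local Notation tau := ((pi : R) *+ 2).

Lemma tau_gt0 : 0 < tau.
Proof. by rewrite pmulrn_lgt0 // pi_gt0. Qed.

Lemma circle_pointD x n : circle_point (x + tau *~ n) = circle_point x.
Proof.
have per f : periodic f tau -> f (x + tau *~ n) = f x :> R.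
  move=> hf; case: n => n; first by rewrite -pmulrn (periodicn hf).
  by rewrite NegzE mulrNz -pmulrn -[in RHS](subrK (tau *+ n.+1) x) (periodicn hf).
by rewrite /circle_point (per _ (@cosD2pi R)) (per _ (@sinD2pi R)).
Qed.

Lemma cos_lt1 x : 0 < x < tau -> cos x != 1.
Proof.
move=> hx; apply/eqP => cx.
have hx2 : 0 < x / 2 < pi by move: hx; rewrite mulr2n; lra.
have := sin_gt0_pi hx2; have := cos2Dsin2 (x / 2).
have : cos ((x / 2) *+ 2) = 1 by rewrite -mulr_natr divfK // pnatr_eq0.
rewrite cos_mulr2n mulr2n => h1 h2 h3.
have : sin (x / 2) ^+ 2 = 0 by lra.
by move/eqP; rewrite sqrf_eq0 => /eqP h; rewrite h ltxx in h3.
Qed.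

Lemma shift_angle t x : exists n, t <= x + tau *~ n < t + tau.
Proof.
have := floor_itv ((x - t) / tau); set m := Num.floor _ => hm.
exists (- m); rewrite mulrNz -mulrzr mulrC.
move: hm; rewrite intrD ler_pdivlMr ?tau_gt0 // ltr_pdivrMr ?tau_gt0 // mulrDl mul1r.
by move: tau tau_gt0 => u; set v := m%:~R * u; lra.
Qed.

Lemma circle_point_eq x y : circle_point x = circle_point y ->
  exists n, x = y + tau *~ n.
Proof.
case=> cxy sxy; have [n hn] := shift_angle 0 (x - y); exists (- n).
have cos1 : cos (x - y + tau *~ n) = 1.
  have [-> _] := circle_pointD (x - y) n.
  by rewrite cosB cxy sxy -!expr2 cos2Dsin2.
move: hn; rewrite le_eqVlt add0r => /andP[/orP[/eqP h0 _|h0 h1]].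
  by rewrite mulrNz; lra.
have : 0 < x - y + tau *~ n < tau by rewrite h0.
by move/cos_lt1; rewrite cos1 eqxx.
Qed.

Lemma arc_of_anglesP a b s :
  arc_of_angles a b (circle_point s) <-> exists n, a < s + tau *~ n < b.
Proof.
split=> [[x hx /circle_point_eq[n def_x]]|[n hn]]; first by exists n; rewrite -def_x.
by exists (s + tau *~ n) => //; exact: circle_pointD.
Qed.

(** Both [s] and [a] are less than one turn past [t], and [b] is at most one turn past [a], so only
    the representatives [s] and [s + tau] can fall between [a] and [b]. *)
Lemma arc_normal t (A : set (R * R)) : open_arc A -> exists a b,
  [/\ t <= a < t + tau, a < b <= a + tau &
   forall s, t <= s < t + tau -> A (circle_point s) <-> a < s < b \/ s + tau < b].
Proof.
case=> a [b [lt_ab le_b ->]]; have [n hn] := shift_angle t a.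
have arcP := @arc_of_anglesP a b; have u0 := tau_gt0.
move: tau u0 hn le_b arcP => u u0 hn le_b arcP.
exists (a + u *~ n), (b + u *~ n); split=> //; first by lra.
move=> s hs; rewrite arcP; split=> [[m hm]|h].
  have eq_m : s + u *~ (m + n) = s + u *~ m + u *~ n by rewrite mulrzDr addrA.
  have {}hm : a + u *~ n < s + u *~ (m + n) < b + u *~ n by lra.
  move: (m + n) hm => k hm {eq_m}; have [k_lt|k_gt|k0] := ltgtP k 0.
  - have : u *~ k <= u *~ (-1) by rewrite ler_pMz2l //; lia.
    by rewrite mulrN1z; lra.
  - have [k_lt2|k_ge2] := ltP k 2.
      have k1 : k = 1 by lia.
      by rewrite k1 mulr1z in hm; right; lra.
    have : u *~ 2 <= u *~ k by rewrite ler_pMz2l.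
    by rewrite -pmulrn mulr2n; lra.
  by rewrite k0 mulr0z in hm; left; lra.
case: h => h.
  by exists (- n); rewrite mulrNz; lra.
by exists (1 - n); rewrite mulrzBr mulr1z; lra.
Qed.

End Angles.

(** * Replacing real arcs by finite sets of witness points *)

Section CircularArc.
Variables (R : realType) (V : finType) (e : rel V) (arc : V -> set (R * R)).
Hypothesis arc_open : forall v, open_arc (arc v).

Local Notation tau := ((pi : R) *+ 2).

(** One point of the first arc for each pair, common to both arcs when they meet: these points
    decide adjacency, and the pairs [(v, v)] keep every arc nonempty. *)
Lemma witness_angles : exists t : V * V -> R, forall w : V * V,
  arc w.1 (circle_point (t w)) /\
  ((arc w.1 `&` arc w.2 !=set0)%classic -> arc w.2 (circle_point (t w))).
Proof.
apply: (fin_all_exists (P := fun w x => arc w.1 (circle_point x) /\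
  ((arc w.1 `&` arc w.2 !=set0)%classic -> arc w.2 (circle_point x)))) => -[u v] /=.
have pointE w p : arc w p -> exists x : R, p = circle_point x.
  by case: (arc_open w) => a [b [_ _ ->]] [x _ <-]; exists x.
have [[p [pu pv]]|none] := boolp.pselect (arc u `&` arc v !=set0)%classic.
  by have [x def_p] := pointE _ _ pu; exists x; rewrite -def_p.
have [a [b [lt_ab _ def_u]]] := arc_open u.
exists ((a + b) / 2); split=> [|/none//].
by rewrite def_u; exists ((a + b) / 2) => //=; lra.
Qed.

Variable t : V * V -> R.

Definition witness_arc v : {set V * V} := [set w | boolp.asbool (arc v (circle_point (t w)))].

Lemma witness_arcP v w : reflect (arc v (circle_point (t w))) (w \in witness_arc v).
Proof. by rewrite inE; apply: boolp.asboolP. Qed.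

Lemma witness_cuttable (o : V * V) : exists N pos,
  in_range N pos /\ forall v, cut_arc o pos (witness_arc v).
Proof.
have [s hs] : exists s : V * V -> R, forall w,
    t o <= s w < t o + tau /\ circle_point (s w) = circle_point (t w).
  apply: (fin_all_exists (P := fun w x => t o <= x < t o + tau /\
    circle_point x = circle_point (t w))) => w.
  have [n hn] := shift_angle (t o) (t w).
  by exists (t w + tau *~ n); rewrite circle_pointD.
(* Positions are ranks within the turn starting at [t o], shifted by one to be positive; equal
   angles share a rank. *)
pose pos w := #|[set w' | s w' < s w]|.+1.
have pos_mono x y : (pos x <= pos y)%N -> s x <= s y.
  rewrite leNgt; apply: contraL => lt_yx; rewrite -ltnNge ltnS.
  apply/proper_card/properP; split.
    by apply/fintype.subsetP => w; rewrite !inE => /lt_trans; apply.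
  by exists y; rewrite inE // ltxx.
exists #|{: V * V}|.+2, pos; split=> [w|v].
  by rewrite /pos /= !ltnS max_card.
have [a [b [ha hab hv]]] := arc_normal (t o) (arc_open v).
have mem_v w : w \in witness_arc v <-> a < s w < b \/ s w + tau < b.
  have [hsw eq_w] := hs w; rewrite -hv // eq_w.
  by split=> /witness_arcP.
(* The turn starts at [t o], which is never past [a], so the arc reaches [o] only by wrapping
   around. *)
have mem_o : o \in witness_arc v <-> t o + tau < b.
  have hto : t o <= t o < t o + tau by have := tau_gt0 R; lra.
  split=> [/witness_arcP/(hv _ hto)|hb]; first by case; lra.
  by apply/witness_arcP/(hv _ hto); right.
rewrite /cut_arc; case: (boolP (o \in witness_arc v)) => o_in.
  have tob := mem_o.1 o_in.
  (* Off an arc that wraps around, the angles are those from [b - tau] to [a]. *)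
  suff out w : w \notin witness_arc v <-> ~ (a < s w < b \/ s w + tau < b).
    move=> x y z; rewrite !finset.in_setC => /out hx /out hz /andP[/pos_mono xy /pos_mono yz].
    apply/out; have [[hsx _] [hsy _] [hsz _]] := And3 (hs x) (hs y) (hs z).
    case=> hy; last by apply: hx; right; lra.
    by apply: hz; left; lra.
  by split=> [/negP h /mem_v|h]; last apply/negP => /mem_v.
have tob : b <= t o + tau by rewrite leNgt; apply: contra o_in => /mem_o.
move=> x y z /mem_v hx /mem_v hz /andP[/pos_mono xy /pos_mono yz]; apply/mem_v.
have [[hsx _] [hsy _] [hsz _]] := And3 (hs x) (hs y) (hs z).
by case: hx => hx; case: hz => hz; left; lra.
Qed.

End CircularArc.

Local Open Scope classical_set_scope.

Theorem theorem1 (R : realType) (V : finType) (e : rel V)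
    (simple_e : simple_graph e) (connected_e : connected_graph e)
    (circular_arc_e : circular_arc_graph R e) :
  \bigcap_(p in longest_path e) [set v : V | v \in p] !=set0.
Proof.
have [arc [arc_open adj]] := circular_arc_e.
have [t ht] := witness_angles arc_open.
pose W v := witness_arc arc t v.
have W_neq0 v : W v != finset.set0.
  by apply/set0Pn; exists (v, v); apply/witness_arcP; have [] := ht (v, v).
have W_adj u v : u != v -> e u v = (W u :&: W v != finset.set0).
  move=> ne; apply/idP/set0Pn => [|[w]].
    case/(adj u v ne) => p [pu pv]; exists (u, v); rewrite finset.inE.
    have [/= hu hv] := ht (u, v); apply/andP; split; apply/witness_arcP => //.
    by apply: hv; exists p.
  rewrite finset.inE => /andP[/witness_arcP wu /witness_arcP wv].
  by apply/(adj u v ne); exists (circle_point (t w)).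
have [v hv] := longest_path_common simple_e connected_e W_neq0 W_adj
  (witness_cuttable arc_open t).
by exists v => p lp /=; apply: hv.
Qed.
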